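(* Let $d$ and $n$ be positive integers. Then \begin{align*} \mathbb{E}[X_{n,dn+1}]&=\frac{d(d+1)(5d+1)(n-1)^2}{24(4d+1)}+\frac{d(d+1)(32d^2+63d+7)(n-1)}{24(4d+1)^2}+\frac{d(d+1)(6d^2+27d+3)}{12(4d+1)^2}\\ &\quad-\frac{M_d(n-1)}{M_d(n)}\Bigl(\frac{d(d+1)(d-1)(n-1)^2}{24(4d+1)}+\frac{d(d+1)(14d^2+21d+1)(n-1)}{24(4d+1)^2}+\frac{d(d+1)(6d^2+27d+3)}{12(4d+1)^2}\Bigr). \end{align*}
   Context: A partition $\lambda=(\lambda_1\ge\dots\ge\lambda_\ell)$ has size $|\lambda|=\sum_i\lambda_i$. The hook length of a box of its Young diagram is the number of boxes directly to its right, directly below it, plus the box itself. For a positive integer $t$, $\lambda$ is a $t$-core if none of its hook lengths is divisible by $t$; an $(s,t)$-core is both an $s$-core and a $t$-core. $X_{n,dn+1}$ is the size of a partition chosen uniformly at random from the finite set of $(n,dn+1)$-core partitions with distinct parts. The sequence $M_d(n)$ is defined by $M_d(-1)=0$, $M_d(0)=1$, $M_d(n)=M_d(n-1)+dM_d(n-2)$ for $n\ge1$ (it is known that $M_d(n)$ equals the number of $(n,dn+1)$-core partitions with distinct parts). *)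

(* Defs.v *)
From mathcomp Require Import all_boot all_order all_algebra finmap.
From mathcomp Require Import boolp classical_sets functions cardinality fsbigop.

Set Implicit Arguments.
Unset Strict Implicit.
Unset Printing Implicit Defensive.

Local Open Scope classical_set_scope.

(* [:: la_1; ...; la_l] with la_1 >= ... >= la_l >= 1, so that each partition
   has a single representative; parts are indexed from 0. *)
Definition is_partition (la : seq nat) : bool := sorted geq la && (0 \notin la).

Definition psize (la : seq nat) : nat := sumn la.

Definition distinct_parts (la : seq nat) : bool := uniq la.

Definition in_diagram (la : seq nat) (i j : nat) : bool :=
  (i < size la) && (j < nth 0 la i).

(* Boxes of row i strictly right of column j. *)
Definition arm (la : seq nat) (i j : nat) : nat := nth 0 la i - j.+1.

(* Rows strictly below row i that have a box in column j. *)
Definition leg (la : seq nat) (i j : nat) : nat :=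
  count (fun p => j < p) (drop i.+1 la).

Definition hook_length (la : seq nat) (i j : nat) : nat :=
  arm la i j + leg la i j + 1.

Definition is_core (t : nat) (la : seq nat) : Prop :=
  forall i j, in_diagram la i j -> ~~ (t %| hook_length la i j).

Definition distinct_cores (s t : nat) : set (seq nat) :=
  [set la | [/\ is_partition la, distinct_parts la, is_core s la & is_core t la]].

(* Expectation of f(Y), with Y uniform on A; meaningful only when A is finite
   and nonempty (otherwise fset_set A is empty and the value is 0 / 0 = 0). *)
Definition uniform_expectation (T : choiceType) (A : set T) (f : T -> nat) : rat :=
  ((\sum_(x <- fset_set A) (f x)%:R) / (#|` fset_set A|)%:R)%R.

Definition expected_core_size (s t : nat) : rat :=
  uniform_expectation (distinct_cores s t) psize.

(* M_shift d k = M_d(k - 1): the shift makes room for M_d(-1) = 0. *)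
Fixpoint M_shift (d k : nat) : nat :=
  match k with
  | 0 => 0
  | 1 => 1
  | (k''.+1 as k').+1 => M_shift d k' + d * M_shift d k''
  end.

Definition M (d n : nat) : nat := M_shift d n.+1.

(* Main.v *)
(** A partition is encoded by the set of its first-column hook lengths
    (beta-set): it is a t-core iff this set is closed under subtracting t, and
    its parts are distinct iff the set has no two consecutive elements.  An
    element x >= dn+1 of the beta-set of an (n,dn+1)-core would put both
    x-dn-1 and x-dn in the set, so all elements are below dn.  The cores with
    distinct parts thus correspond to the lists (a_1,...,a_(n-1)) with entries
    in {0,...,d} and no two adjacent nonzero entries, where a_r counts the
    elements of residue r mod n.  The size is the sum of the beta-set minus
    'C(sum of the a_r, 2); deleting the last entry, or the last two when the
    last is nonzero, gives recurrences of the same shape as that of M_d, which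
    the closed forms satisfy. *)
Require Import Defs.
From mathcomp Require Import all_boot all_order all_algebra.
From mathcomp Require Import finmap zify ring.
From mathcomp Require Import classical_sets cardinality.

Import GRing.Theory Num.Theory.

Local Open Scope nat_scope.

(** * Beta-sets of partitions *)

(* In decreasing order: the i-th entry is the hook length of box (i,0). *)
Fixpoint beta_set (la : seq nat) : seq nat :=
  if la is p :: l then p + size l :: beta_set l else [::].

(** An entry of a strictly decreasing list of positive numbers exceeds the number of later ones, so
    there the truncated subtraction is exact. *)
Fixpoint beta_partition (b : seq nat) : seq nat :=
  if b is x :: c then x - size c :: beta_partition c else [::].

Lemma size_beta_set la : size (beta_set la) = size la.
Proof. by elim: la => //= p l ->. Qed.

Lemma size_beta_partition b : size (beta_partition b) = size b.
Proof. by elim: b => //= x c ->. Qed.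

Lemma beta_setK la : beta_partition (beta_set la) = la.
Proof. by elim: la => //= p l ->; rewrite size_beta_set addnK. Qed.

(** Each row is raised by the number of rows below it; these numbers add up to the binomial. *)
Lemma sumn_beta_set la : sumn (beta_set la) = psize la + 'C(size la, 2).
Proof.
rewrite /psize; elim: la => //= p l ->; rewrite binS bin1; lia.
Qed.

Lemma is_partition_cons p l :
  is_partition (p :: l) = [&& 0 < p, all (geq p) l & is_partition l].
Proof.
rewrite /is_partition /= path_sortedE; last by move=> x y z /=; lia.
by rewrite inE negb_or eq_sym lt0n; case: (p != 0); rewrite //= -?andbA ?andbF.
Qed.

Lemma gtn_sorted_cons x c :
  sorted gtn (x :: c) = all (gtn x) c && sorted gtn c.
Proof. by rewrite /= path_sortedE // => y z t /=; lia. Qed.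

Lemma beta_set_bound q la : all (geq q) la -> all (gtn (q + size la)) (beta_set la).
Proof.
elim: la q => //= p l IH q /andP[pq /IH ql]; apply/andP; split; first lia.
by apply: sub_all ql => x /=; lia.
Qed.

(** Successive parts [p], [q] give elements that differ by [p - q + 1], so weak decrease becomes
    strict; the last element is the last part. *)
Lemma is_partition_beta_set la :
  is_partition la = sorted gtn (beta_set la) && (0 \notin beta_set la).
Proof.
elim: la => // p l IH; rewrite is_partition_cons [beta_set _]/= gtn_sorted_cons.
rewrite inE negb_or -andbA IH.
case: (boolP (sorted gtn _)) => sl; rewrite ?andbF //=.
case: (boolP (0 \notin _)) IH => l0; rewrite ?andbF ?andbT //= sl => part_l.
case: l part_l sl l0 => [|q l] part_l sl l0 /=; first by rewrite addn0; lia.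
move: part_l; rewrite is_partition_cons => /and3P[q_gt0 ql _].
apply/idP/idP => [/andP[p_gt0 /andP[qp _]] | /andP[/andP[qp _] _]].
  rewrite -andbA; apply/and3P; split; [lia| |lia].
  by apply: sub_all (beta_set_bound q l ql) => x /=; lia.
apply/andP; split; first lia.
apply/andP; split; first by move: qp; rewrite /=; lia.
by apply: sub_all ql => x /=; lia.
Qed.

(** Below [x] there are only [x - 1] positive numbers; [[::]] is set apart because [x] may then be
    0. *)
Lemma size_gtn_sorted b :
  sorted gtn b -> 0 \notin b -> forall x, all (gtn x) b -> size b < x \/ b = [::].
Proof.
elim: b => [|y c IH]; first by right.
rewrite gtn_sorted_cons inE negb_or => /andP[yc sc] /andP[y0 c0] x /= /andP[yx _].
by left; case: (IH sc c0 y yc) => [|->] /=; lia.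
Qed.

Lemma beta_partitionK b :
  sorted gtn b -> 0 \notin b -> beta_set (beta_partition b) = b.
Proof.
elim: b => // y c IH; rewrite gtn_sorted_cons inE negb_or => /andP[yc sc] /andP[y0 c0].
rewrite /= IH // size_beta_partition subnK //.
by case: (size_gtn_sorted _ sc c0 _ yc) => [|->] /=; lia.
Qed.

(** * Distinct parts and cores in terms of the beta-set *)

(** The difference [p - q + 1] of neighbouring elements is 1 exactly when the parts are equal. *)
Lemma uniq_beta_set la : is_partition la ->
  uniq la <-> (forall x, x \in beta_set la -> x.+1 \notin beta_set la).
Proof.
elim: la => // p l IH; rewrite is_partition_cons => /and3P[p_gt0 pl part_l].
have lt_beta := allP (beta_set_bound _ _ pl).
(* As the parts decrease, a second [p] would be the head of [l], with element [(p + size l).-1]. *)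
have -> : uniq (p :: l) = ((p + size l).-1 \notin beta_set l) && uniq l.
  congr andb; case: l pl part_l {IH lt_beta} => // q l /= /andP[qp pl].
  rewrite is_partition_cons => /and3P[q_gt0 ql _].
  rewrite !inE addnS /= eqn_add2r; congr (~~ _).
  have [//|neq_pq] := eqVneq p q.
  have lt_qp : q < p by rewrite ltn_neqAle eq_sym neq_pq.
  apply/idP/idP => [/(allP ql) | /(allP (beta_set_bound _ _ ql))] /=; lia.
split=> [/andP[p_l /(IH part_l) sparse_l] x | sparse].
  rewrite !inE negb_or => /orP[/eqP-> | x_l].
    apply/andP; split; first lia.
    by apply/negP => /lt_beta /=; lia.
  rewrite sparse_l // andbT; apply: contra p_l => /eqP <-; exact: x_l.
apply/andP; split.
  apply/negP => p_l; have := sparse (p + size l).-1.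
  by rewrite prednK ?ltn_addr // !inE p_l eqxx orbT => /(_ isT).
apply: (IH part_l).2 => x x_l; have := sparse x.
by rewrite !inE x_l orbT negb_or => /(_ isT) /andP[].
Qed.

Lemma hook_length_head p l j : j < p ->
  hook_length (p :: l) 0 j + (j + count (geq j) l) = p + size l.
Proof.
move=> jp; rewrite /hook_length /arm /leg /= drop0 -(count_predC (geq j) l).
have -> : count (predC (geq j)) l = count (fun q => j < q) l.
  by apply: eq_count => x /=; rewrite ltnNge.
lia.
Qed.

Lemma count_geq_full p l : all (geq p) l -> forall j, p <= j -> count (geq j) l = size l.
Proof.
move=> pl j pj; apply/eqP; rewrite -all_count.
by apply: sub_all pl => x /=; lia.
Qed.

(* With [hook_length_head]: the hook lengths of the first row [p] are the
   differences [p + size l - y] with [y] a smaller non-element. *)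
Lemma notin_beta_setP la y : is_partition la ->
  y \notin beta_set la <-> exists j, y = j + count (geq j) la.
Proof.
elim: la y => [|p l IH] y /=; first by split=> // _; exists y; rewrite addn0.
rewrite is_partition_cons inE negb_or => /and3P[p_gt0 pl part_l].
have lt_beta := allP (beta_set_bound _ _ pl).
split=> [/andP[y_p /(IH _ part_l)[j def_y]] | [j ->]].
  have [jp|pj] := ltnP j p; first by exists j; rewrite leqNgt jp.
  move: def_y; rewrite (count_geq_full _ _ pl) // => def_y.
  (* Since [y] is not [p + size l], here [p < j]; at [j.-1] the row [p] is counted as well, which
     restores the lost unit. *)
  by exists j.-1; rewrite (count_geq_full _ _ pl); lia.
have [pj|jp] /= := leqP p j.
  rewrite (count_geq_full _ _ pl) //; apply/andP; split; first lia.
  by apply/negP => /lt_beta /=; lia.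
have := count_size (geq j) l; rewrite add0n => le_sz.
apply/andP; split; first lia.
by apply/(IH _ part_l); exists j.
Qed.

Lemma is_core_cons t p l :
  is_core t (p :: l) <->
  (forall j, j < p -> ~~ (t %| hook_length (p :: l) 0 j)) /\ is_core t l.
Proof.
split=> [core | [core0 core_l] [|i] j].
- by split=> [j jp | i j ij]; [apply: (core 0) | apply: (core i.+1)].
- by rewrite /in_diagram /= => /core0.
- exact: core_l.
Qed.

(** If [x - t] is missing for the largest element [x], the first row has a hook length equal to [t].
    Conversely a hook length [k * t] leads from [x] by [k] subtractions of [t] to a non-element, so
    one of them leaves the set. *)
Lemma is_core_beta_set t la : 0 < t -> is_partition la ->
  is_core t la <->
  (forall x, x \in beta_set la -> t <= x -> x - t \in beta_set la).
Proof.
move=> t_gt0; elim: la => // p l IH; rewrite is_partition_cons.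
case/and3P=> p_gt0 pl part_l.
have lt_beta := allP (beta_set_bound _ _ pl).
rewrite is_core_cons IH //; split=> [[core0 core_l] x | closed].
  rewrite !inE => /orP[/eqP-> {x} t_le | x_l t_le]; last first.
    by rewrite core_l ?orbT.
  apply/orP; right; apply/negPn/negP => /(notin_beta_setP _ _ part_l) [j def_y].
  have jp : j < p.
    rewrite ltnNge; apply/negP => pj; move: def_y.
    by rewrite (count_geq_full _ _ pl) //; lia.
  have := hook_length_head _ l _ jp => hookE.
  by have /negP := core0 j jp; apply; apply/dvdnP; exists 1; lia.
have closed_l x : x \in beta_set l -> t <= x -> x - t \in beta_set l.
  move=> x_l t_le; have := closed x; rewrite !inE x_l orbT => /(_ isT t_le).
  by have /= lt_x := lt_beta x x_l; case/orP=> // /eqP; lia.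
split=> // j jp; apply/negP => /dvdnP[k hookE].
have := hook_length_head _ l _ jp; rewrite hookE => def_p.
have k_gt0 : 0 < k by move: hookE; rewrite /hook_length; lia.
have : j + count (geq j) l \notin beta_set l.
  by apply/(notin_beta_setP _ _ part_l); exists j.
case/negP; move: (j + _) def_p {hookE} => y.
case: k k_gt0 => // k _; rewrite mulSn => def_p.
(* The first subtraction goes from the head into the beta-set of [l]; the remaining [k] stay there
   and reach [y]. *)
have : k * t + y \in beta_set l.
  have t_le : t <= p + size l by lia.
  have := closed (p + size l); rewrite !inE eqxx => /(_ isT t_le).
  have -> : p + size l - t = k * t + y by lia.
  by case/orP=> // /eqP; lia.
elim: k {def_p} => //= k IHk; rewrite mulSn => /closed_l; rewrite -addnA addKn => H.
by apply: IHk; apply: H; lia.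
Qed.

Lemma beta_set_inj : injective beta_set.
Proof. exact: can_inj beta_setK. Qed.

(** * Admissible lists of bead counts *)

(** A nonzero head forces a zero after it, hence the two-step recursion; a single entry has no
    successor, hence the case [m = 1]. *)
Fixpoint bead_counts (d m : nat) : seq (seq nat) :=
  match m with
  | 0 => [:: [::]]
  | 1 => [seq [:: k] | k <- iota 0 d.+1]
  | (m''.+1 as m').+1 =>
      [seq 0 :: a | a <- bead_counts d m'] ++
      [seq [:: k, 0 & a] | k <- iota 1 d, a <- bead_counts d m'']
  end.

Definition one_zero (x y : nat) : bool := (x == 0) || (y == 0).

Lemma mem_bead_counts d m a :
  (a \in bead_counts d m) = [&& size a == m, all (geq d) a & sorted one_zero a].
Proof.
suff: (forall a, (a \in bead_counts d m) =
         [&& size a == m, all (geq d) a & sorted one_zero a]) /\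
      (forall a, (a \in bead_counts d m.+1) =
         [&& size a == m.+1, all (geq d) a & sorted one_zero a]) by case.
elim: m {a} => [|m [IH1 IH2]]; split=> // a.
- by rewrite inE; case: a.
- rewrite -[bead_counts d 1]/([seq [:: k] | k <- iota 0 d.+1]).
  apply/mapP/idP => [[k k_d ->] /= | ].
    by move: k_d; rewrite mem_iota; lia.
  case: a => [|k [|]] //=; rewrite !andbT => kd.
  by exists k; rewrite // -[_ :: _]/(iota 0 d.+1) mem_iota; lia.
rewrite -[bead_counts d m.+2]/([seq 0 :: a | a <- bead_counts d m.+1] ++
  [seq [:: k, 0 & a] | k <- iota 1 d, a <- bead_counts d m]).
rewrite mem_cat; apply/idP/idP.
  case/orP=> [/mapP[b] | /allpairsP[[k b] /= [k_d]]].
    rewrite IH2 => /and3P[/eqP sz le_d srt] -> /=.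
    apply/and3P; split=> //; first by rewrite sz.
    by case: b srt {sz le_d} => //= x b ->; rewrite /one_zero eqxx.
  rewrite IH1 => /and3P[/eqP sz le_d srt] -> /=.
  rewrite mem_iota in k_d; apply/and3P; split; first by rewrite sz.
    by apply/andP; split=> //; lia.
  rewrite /one_zero eqxx orbT /=.
  by case: b srt {sz le_d} => //= x b ->; rewrite eqxx.
case: a => [|[|k] a] //= /and3P[sz le_d srt].
  apply/orP; left; apply: map_f; rewrite IH2 -eqSS sz le_d /=.
  exact: path_sorted srt.
apply/orP; right; move: sz le_d srt; case: a => [|[|y] a] //= sz /andP[kd ad] srt.
apply/allpairsP; exists (k.+1, a); split=> //=; first by rewrite mem_iota; lia.
by rewrite IH1 -2!eqSS sz ad (path_sorted srt).
Qed.

Lemma uniq_bead_counts d m : uniq (bead_counts d m).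
Proof.
suff: uniq (bead_counts d m) /\ uniq (bead_counts d m.+1) by case.
elim: m => [|m [IH1 IH2]]; split=> //.
  by rewrite map_inj_uniq ?iota_uniq // => x y [].
rewrite /bead_counts -/(bead_counts d m.+1) -/(bead_counts d m) cat_uniq.
apply/and3P; split.
- by rewrite map_inj_uniq // => x y [].
- apply/hasPn => _ /allpairsP[[k b] /= [k_d _ ->]].
  by apply/mapP => -[c _ [k0 _]]; move: k_d; rewrite k0 mem_iota.
- by apply: allpairs_uniq => // [|[k a] [l b] _ _ [-> ->]]; rewrite ?iota_uniq.
Qed.

(** Entry [r] of [0 :: rev a] is the number of beads of residue [r]. Residue 0 has none: closure
    under subtracting [n] would bring 0 into the beta-set. *)
Lemma bead_counts_nth_le d m a r : a \in bead_counts d m -> nth 0 (0 :: rev a) r <= d.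
Proof.
rewrite mem_bead_counts => /and3P[_ /allP le_d _].
have [lt_r|] := ltnP r (size (0 :: rev a)); last by move/(nth_default 0) ->.
have := mem_nth 0 lt_r; rewrite inE mem_rev => /orP[/eqP-> //|/le_d].
by [].
Qed.

Lemma bead_counts_nth_sparse d m a r : a \in bead_counts d m ->
  one_zero (nth 0 (0 :: rev a) r) (nth 0 (0 :: rev a) r.+1).
Proof.
rewrite mem_bead_counts => /and3P[_ _ srt].
have [lt_r|ge_r] := ltnP r.+1 (size (0 :: rev a)); last first.
  by rewrite /one_zero (nth_default 0 ge_r) eqxx orbT.
apply: (sortedP 0 _) lt_r.
have : sorted one_zero (rev a).
  by rewrite rev_sorted; apply: sub_sorted srt => x y; rewrite /one_zero orbC.
by case: (rev a) => //= x s ->; rewrite /one_zero eqxx.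
Qed.

(** * Abacus with [n] runners *)

(* The head of [a] counts the beads on the last runner, of residue [size a]. *)
Fixpoint beads (n : nat) (a : seq nat) : seq nat :=
  if a is k :: c then [seq q * n + (size c).+1 | q <- iota 0 k] ++ beads n c
  else [::].

(** A number [x] sits at height [x %/ n] on runner [x %% n], and the beads of a runner fill its
    lowest heights. *)
Lemma mem_beads n a x : size a < n ->
  (x \in beads n a) = (x %/ n < nth 0 (0 :: rev a) (x %% n)).
Proof.
elim: a => [|k c IH] /= lt_n; first by case: (x %% n) => [|[|r]].
rewrite mem_cat IH; last exact: ltnW.
rewrite rev_cons -rcons_cons nth_rcons /= size_rev.
have -> : (x \in [seq q * n + (size c).+1 | q <- iota 0 k])
          = (x %% n == (size c).+1) && (x %/ n < k).
  apply/mapP/andP => [[q] | [/eqP xr xq]].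
    rewrite mem_iota add0n => /andP[_ qk] ->.
    rewrite modnMDl modn_small // divnMDl ?divn_small ?addn0 ?eqxx //; lia.
  by exists (x %/ n); rewrite ?mem_iota // -xr -divn_eq.
case: (ltngtP (x %% n) (size c).+1) => r_c //.
  by rewrite (@nth_default _ _ (0 :: rev c)) //= size_rev ltnW.
by rewrite (@nth_default _ _ (0 :: rev c)) ?orbF //= size_rev r_c.
Qed.

Lemma uniq_beads n a : size a < n -> uniq (beads n a).
Proof.
elim: a => //= k c IH lt_n; rewrite cat_uniq IH ?(ltnW lt_n) // andbT.
rewrite map_inj_uniq ?iota_uniq /= => [|x y]; last first.
  by move/addIn/eqP; rewrite eqn_pmul2r ?(leq_trans _ lt_n) // => /eqP.
apply/hasPn => x; rewrite mem_beads ?(ltnW lt_n) // => x_c.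
apply/negP => /mapP[q _ def_x]; move: x_c.
by rewrite def_x modnMDl modn_small // nth_default //= size_rev.
Qed.

Lemma size_beads n a : size (beads n a) = sumn a.
Proof. by elim: a => //= k c IH; rewrite size_cat size_map size_iota IH. Qed.

Lemma sumn_beads_cons n k c :
  sumn (beads n (k :: c)) = 'C(k, 2) * n + k * (size c).+1 + sumn (beads n c).
Proof.
rewrite /= sumn_cat; congr addn.
elim: k => // k IH.
by rewrite -[in iota _ _]addn1 iotaD cats1 map_rcons sumn_rcons IH binS bin1; lia.
Qed.

Definition core_of_counts (n : nat) (a : seq nat) : seq nat :=
  beta_partition (sort geq (beads n a)).

Lemma geq_total : total geq.
Proof. by move=> x y /=; rewrite leq_total. Qed.

Lemma sort_beads_sorted n a : size a < n ->
  sorted gtn (sort geq (beads n a)) && (0 \notin sort geq (beads n a)).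
Proof.
move=> lt_n; rewrite gtn_sorted_uniq_geq sort_uniq uniq_beads // (sort_sorted geq_total).
by rewrite mem_sort mem_beads // div0n mod0n.
Qed.

Lemma beta_core_of_counts n a : size a < n ->
  beta_set (core_of_counts n a) = sort geq (beads n a).
Proof. by case/sort_beads_sorted/andP => s s0; apply: beta_partitionK. Qed.

Lemma psize_core_of_counts n a : size a < n ->
  psize (core_of_counts n a) + 'C(sumn a, 2) = sumn (beads n a).
Proof.
move=> lt_n; rewrite -(size_beads n) -(size_sort geq) -size_beta_partition.
rewrite -sumn_beta_set beta_core_of_counts //.
by apply: perm_sumn; rewrite perm_sort.
Qed.

Lemma core_of_counts_inj n a b : (size a).+1 = n -> (size b).+1 = n ->
  core_of_counts n a = core_of_counts n b -> a = b.
Proof.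
move=> sz_a sz_b /(congr1 beta_set); rewrite !beta_core_of_counts ?sz_a ?sz_b //.
move=> eq_s; have eq_b x : (x \in beads n a) = (x \in beads n b).
  by rewrite -(mem_sort geq) eq_s mem_sort.
suff: 0 :: rev a = 0 :: rev b by case=> /(can_inj revK).
apply: (@eq_from_nth _ 0) => /=; first by rewrite !size_rev; lia.
rewrite size_rev sz_a => r lt_r.
have lt_nth q : (q < nth 0 (0 :: rev a) r) = (q < nth 0 (0 :: rev b) r).
  have := eq_b (q * n + r); rewrite !mem_beads ?sz_a ?sz_b //.
  by rewrite modnMDl modn_small // divnMDl ?divn_small ?addn0 //; lia.
have [lt|lt|//] := ltngtP (nth 0 (0 :: rev a) r) (nth 0 (0 :: rev b) r).
  by rewrite -lt_nth ltnn in lt.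
by rewrite lt_nth ltnn in lt.
Qed.

(** * Bijection between bead counts and cores *)

Lemma core_of_counts_distinct d n a : 0 < n -> a \in bead_counts d n.-1 ->
  distinct_cores n (d * n + 1) (core_of_counts n a).
Proof.
move=> n_gt0 a_adm.
have /eqP sz_a : size a == n.-1 by move: a_adm; rewrite mem_bead_counts => /and3P[].
have lt_n : size a < n by rewrite sz_a; lia.
have part_a : is_partition (core_of_counts n a).
  by rewrite is_partition_beta_set beta_core_of_counts // sort_beads_sorted.
have memE x : (x \in beta_set (core_of_counts n a)) =
              (x %/ n < nth 0 (0 :: rev a) (x %% n)).
  by rewrite beta_core_of_counts // mem_sort mem_beads.
split=> //.
- apply/(uniq_beta_set _ part_a) => x; rewrite !memE => x_in; apply/negP.
  have modS : x.+1 %% n = (x %% n).+1 %% n by rewrite -addn1 -modnDml addn1.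
  (* After the last runner, [x.+1] falls on the empty runner 0; otherwise it lies at the same height
     on the next runner. *)
  have [x_n|x_n] := eqVneq (x %% n).+1 n; first by rewrite modS x_n modnn.
  have lt_mod := ltn_pmod x n_gt0.
  rewrite modS (modn_small (m := (x %% n).+1)); last by rewrite ltn_neqAle x_n.
  have := bead_counts_nth_sparse _ _ _ (x %% n) a_adm; rewrite /one_zero.
  case/orP=> /eqP nth0; last by rewrite nth0.
  by rewrite nth0 in x_in.
- apply/(is_core_beta_set _ _ n_gt0 part_a) => x; rewrite !memE => x_in n_x.
  rewrite -{2}(subnK n_x) modnDr in x_in; apply: leq_ltn_trans x_in.
  by apply: leq_div2r; apply: leq_subr.
(* All elements lie below [d * n], so this closure is vacuous. *)
- apply/is_core_beta_set => //; first by rewrite addn1.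
  move=> x; rewrite !memE => x_in.
  have := leq_trans x_in (bead_counts_nth_le _ _ _ _ a_adm).
  by rewrite ltn_divLR //; lia.
Qed.

Lemma beta_set_lt d n la : 0 < d -> 0 < n -> distinct_cores n (d * n + 1) la ->
  forall x, x \in beta_set la -> x < d * n.
Proof.
move=> d_gt0 n_gt0 [part_la uniq_la core_n core_dn] x x_in.
have /andP[_ zero_notin] := etrans (esym (is_partition_beta_set la)) part_la.
have closed_n := (is_core_beta_set _ _ n_gt0 part_la).1 core_n.
have closed k : k * n <= x -> x - k * n \in beta_set la.
  elim: k => [|k IH] le_x; first by rewrite subn0.
  by rewrite mulSn addnC subnDA closed_n //; [apply: IH|]; lia.
rewrite ltnNge; apply/negP => le_x.
(* From [d * n], subtracting [n] repeatedly would reach 0. *)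
have [eq_x|neq_x] := eqVneq x (d * n).
  by move: (closed d); rewrite eq_x subnn leqnn => /(_ isT); apply/negP.
have dn_gt0 : 0 < d * n + 1 by rewrite addn1.
have lt_x : d * n + 1 <= x by lia.
have y_in := (is_core_beta_set _ _ dn_gt0 part_la).1 core_dn x x_in lt_x.
have /negP := (uniq_beta_set _ part_la).1 uniq_la _ y_in; apply.
have -> : (x - (d * n + 1)).+1 = x - d * n by lia.
exact: closed.
Qed.

Lemma distinct_core_counts d n la : 0 < d -> 0 < n ->
  distinct_cores n (d * n + 1) la ->
  exists2 a, a \in bead_counts d n.-1 & la = core_of_counts n a.
Proof.
move=> d_gt0 n_gt0 la_core; have lt_dn := beta_set_lt _ _ _ d_gt0 n_gt0 la_core.
case: la_core => part_la uniq_la core_n _.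
have /andP[srt zero_notin] := etrans (esym (is_partition_beta_set la)) part_la.
have closed_n := (is_core_beta_set _ _ n_gt0 part_la).1 core_n.
(* The height of the first gap on runner [r]; [find] returns [d] if there is no gap below height
   [d]. *)
pose f r := find (fun q => q * n + r \notin beta_set la) (iota 0 d).
have f_le r : f r <= d by rewrite -[leqRHS](size_iota 0); apply: find_size.
have lt_f q r : r < n -> (q < f r) = (q * n + r \in beta_set la).
  move=> r_n; have [q_f|f_q] := ltnP q (f r).
    have := before_find 0 q_f; rewrite nth_iota ?add0n; last exact: leq_trans (f_le r).
    by move/negbFE.
  (* An element above the gap would descend by steps of [n] into the gap itself. *)
  apply/esym/negP => q_in.
  have f_in : f r * n + r \in beta_set la.
    rewrite -(subnK f_q) in q_in; move: (q - f r) q_in => k.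
    elim: k => // k IH /closed_n; rewrite addSn mulSn -addnA addKn => H.
    by apply/IH/H; lia.
  have f_d : f r < d.
    have := lt_dn _ f_in => H; rewrite -(ltn_pmul2r n_gt0); lia.
  have := f_d; rewrite -{1}(size_iota 0 d) -has_find => /(nth_find 0).
  by rewrite -/(f r) nth_iota // f_in.
have f0 : f 0 = 0.
  by apply/eqP; rewrite -leqn0 leqNgt lt_f.
pose a := rev [seq f r | r <- iota 1 n.-1].
have cons_a : 0 :: rev a = mkseq f n.
  by rewrite revK /mkseq -{2}(prednK n_gt0) /= f0.
have sz_a : size a = n.-1 by rewrite size_rev size_map size_iota.
have a_adm : a \in bead_counts d n.-1.
  rewrite mem_bead_counts sz_a eqxx all_rev rev_sorted andTb; apply/andP; split.
    by apply/allP => _ /mapP[r _ ->]; apply: f_le.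
  apply/(sortedP 0) => r; rewrite size_map size_iota => lt_r.
  rewrite !(nth_map 0) ?size_iota ?nth_iota //; try lia.
  apply/negPn/negP; rewrite /one_zero negb_or -!lt0n !lt_f ?mul0n ?add0n; try lia.
  case/andP=> r1 r0; have := (uniq_beta_set _ part_la).1 uniq_la _ r0.
  by move: r1; rewrite addnS => ->.
exists a => //; apply: beta_set_inj; rewrite beta_core_of_counts ?sz_a ?prednK //.
have lt_n : size a < n by rewrite sz_a; lia.
apply: (irr_sorted_eq (leT := gtn)) => //.
- by move=> x y z /=; lia.
- by move=> x /=; rewrite ltnn.
- by have /andP[] := sort_beads_sorted _ _ lt_n.
move=> x; rewrite mem_sort mem_beads // cons_a nth_mkseq ?ltn_pmod //.
by rewrite lt_f ?ltn_pmod // -divn_eq.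
Qed.

(** * Sums over the lists of bead counts *)

Local Open Scope ring_scope.

Lemma bin2_rat k : 'C(k, 2)%:R = k%:R * (k%:R - 1) / 2 :> rat.
Proof.
elim: k => [|k IH]; first by rewrite bin0n !mul0r.
by rewrite binS bin1 natrD IH -natr1; field.
Qed.

Lemma sum_const_seq (T : Type) (s : seq T) (x : rat) :
  \sum_(i <- s) x = (size s)%:R * x.
Proof. by rewrite big_const_seq count_predT iter_addr_0 mulr_natl. Qed.

Lemma sum_id_rat d : \sum_(1 <= k < d.+1) k%:R = d%:R * (d%:R + 1) / 2 :> rat.
Proof.
elim: d => [|d IH]; first by rewrite big_geq // !mul0r.
by rewrite big_nat_recr //= IH -natr1; field.
Qed.

Lemma sum_bin2_rat d :
  \sum_(1 <= k < d.+1) 'C(k, 2)%:R = (d%:R - 1) * d%:R * (d%:R + 1) / 6 :> rat.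
Proof.
elim: d => [|d IH]; first by rewrite big_geq // mulr0 !mul0r.
by rewrite big_nat_recr //= IH bin2_rat -natr1; field.
Qed.

Lemma sum_bead_counts (f : seq nat -> rat) d m :
  \sum_(a <- bead_counts d m.+2) f a =
  \sum_(a <- bead_counts d m.+1) f (0%N :: a) +
  \sum_(a <- bead_counts d m) \sum_(1 <= k < d.+1) f [:: k, 0%N & a].
Proof.
rewrite -[bead_counts d m.+2]/([seq 0%N :: a | a <- bead_counts d m.+1] ++
  [seq [:: k, 0%N & a] | k <- iota 1 d, a <- bead_counts d m]).
by rewrite big_cat big_map big_allpairs_dep exchange_big /index_iota subn1.
Qed.

Lemma sum_bead_counts1 (f : seq nat -> rat) d :
  \sum_(a <- bead_counts d 1) f a = f [:: 0%N] + \sum_(1 <= k < d.+1) f [:: k].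
Proof. by rewrite /bead_counts big_map /= big_cons /index_iota subn1. Qed.

Lemma M_recS d m : M d m.+2 = (M d m.+1 + d * M d m)%N.
Proof. by []. Qed.

Lemma M_0 d : M d 0 = 1%N.
Proof. by []. Qed.

Lemma M_1 d : M d 1 = 1%N.
Proof. by rewrite /M /= muln0. Qed.

(** A zero head leaves a list one shorter, each of the [d] nonzero heads one two shorter: the
    recurrence of [M]. *)
Lemma size_bead_counts d m : size (bead_counts d m) = M d m.+1.
Proof.
suff: size (bead_counts d m) = M d m.+1 /\ size (bead_counts d m.+1) = M d m.+2 by case.
elim: m => [|m [IH1 IH2]]; split=> //; first by rewrite M_1.
  by rewrite /bead_counts size_map size_iota M_recS M_1 muln1.
rewrite M_recS -IH1 -IH2 -[bead_counts d m.+2]/([seq 0%N :: a | a <- bead_counts d m.+1] ++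
  [seq [:: k, 0%N & a] | k <- iota 1 d, a <- bead_counts d m]).
by rewrite size_cat size_map size_allpairs size_iota.
Qed.

Lemma four_mul_add1_neq0 d : 4 * d%:R + 1 != 0 :> rat.
Proof. by rewrite -natrM natr1 pnatr_eq0. Qed.

(** Both sides satisfy $S(m+2)=S(m+1)+d\,S(m)+\frac{d(d+1)}{2}M_d(m+1)$. *)
Lemma sum_sumn_bead_counts d m :
  \sum_(a <- bead_counts d m) (sumn a)%:R =
  d%:R * (d%:R + 1) / (2 * (4 * d%:R + 1))
  * ((2 * m%:R + 2) * (M d m.+1)%:R - (m%:R + 2) * (M d m)%:R) :> rat.
Proof.
have nz := four_mul_add1_neq0 d.
pose P m := \sum_(a <- bead_counts d m) (sumn a)%:R =
  d%:R * (d%:R + 1) / (2 * (4 * d%:R + 1))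
  * ((2 * m%:R + 2) * (M d m.+1)%:R - (m%:R + 2) * (M d m)%:R) :> rat.
suff: P m /\ P m.+1 by case.
elim: m => [|m [IH1 IH2]]; split=> //; rewrite /P.
- by rewrite big_seq1 M_1 M_0 /=; field.
- rewrite sum_bead_counts1 add0r; under eq_bigr do rewrite /= addn0.
  by rewrite sum_id_rat M_recS M_1 M_0 muln1 natrD; field.
rewrite sum_bead_counts /= IH2.
rewrite (eq_bigr (fun a : seq nat =>
  d%:R * (d%:R + 1) / 2 + d%:R * (sumn a)%:R)); last first.
  move=> a _; under eq_bigr do rewrite natrD.
  by rewrite big_split /= sum_id_rat sum_const_seq size_iota subn1.
rewrite big_split /= sum_const_seq -mulr_sumr IH1 size_bead_counts.
(* All values of [M] reduce to two, treated as free variables in a rational identity. *)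
rewrite (M_recS d m.+1) (M_recS d m); move: (M d m.+1) (M d m) => v w.
rewrite !natrD !natrM -!natr1; field.
exact: nz.
Qed.

(** * Sum of the core sizes *)

(* Size of [core_of_counts n a], written with a rational subtraction. *)
Definition core_size (n : nat) (a : seq nat) : rat :=
  (sumn (beads n a))%:R - 'C(sumn a, 2)%:R.

Lemma core_size_cons0 n a : core_size n (0%N :: a) = core_size n a.
Proof. by []. Qed.

(** The new runner adds [n * 'C(k, 2) + k * (size a + 1)], while 'C(k + s, 2) = 'C(k, 2) + 'C(s, 2)
    + k s with [s = sumn a]. *)
Lemma core_size_cons n k a : core_size n (k :: a) =
  core_size n a + (n%:R - 1) * 'C(k, 2)%:R
  + k%:R * ((size a)%:R + 1) - k%:R * (sumn a)%:R.
Proof.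
rewrite /core_size sumn_beads_cons !natrD !natrM -natr1 !bin2_rat /= natrD.
by field.
Qed.

(* The residue modulus [N] is kept apart from the number [m] of residues so that
   an induction on [m] is possible.  At [N = m + 1] the last summand, which is
   [(N - 1 - m)] times the sum of all 'C(a_r, 2), vanishes. *)
Definition core_size_sum (d N m v w : rat) : rat :=
  v * (d * (d + 1) * (5 * d + 1) * m ^+ 2 / (24 * (4 * d + 1))
    + d * (d + 1) * (32 * d ^+ 2 + 63 * d + 7) * m / (24 * (4 * d + 1) ^+ 2)
    + d * (d + 1) * (6 * d ^+ 2 + 27 * d + 3) / (12 * (4 * d + 1) ^+ 2))
  - w * (d * (d + 1) * (d - 1) * m ^+ 2 / (24 * (4 * d + 1))
    + d * (d + 1) * (14 * d ^+ 2 + 21 * d + 1) * m / (24 * (4 * d + 1) ^+ 2)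
    + d * (d + 1) * (6 * d ^+ 2 + 27 * d + 3) / (12 * (4 * d + 1) ^+ 2))
  + (N - 1 - m) * (d - 1) / 3 *
    (d * (d + 1) / (2 * (4 * d + 1)) * ((2 * m + 2) * v - (m + 2) * w)).

Lemma sum_core_size d n m :
  \sum_(a <- bead_counts d m) core_size n a =
  core_size_sum d%:R n%:R m%:R (M d m.+1)%:R (M d m)%:R.
Proof.
have nz := four_mul_add1_neq0 d.
pose P m := \sum_(a <- bead_counts d m) core_size n a =
  core_size_sum d%:R n%:R m%:R (M d m.+1)%:R (M d m)%:R.
suff: P m /\ P m.+1 by case.
elim: m => [|m [IH1 IH2]]; split=> //; rewrite /P.
- by rewrite big_seq1 /core_size /= bin0n subrr M_1 M_0 /core_size_sum; field.
- rewrite sum_bead_counts1 /core_size_sum.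
  have core0 : core_size n [::] = 0 by rewrite /core_size subrr.
  under eq_bigr do rewrite core_size_cons core0 /= mulr0 subr0 !add0r mulr1.
  rewrite core_size_cons0 core0 add0r.
  rewrite big_split /= -mulr_sumr sum_id_rat sum_bin2_rat M_recS M_1 M_0 muln1 natrD.
  by field.
rewrite sum_bead_counts.
under eq_bigr do rewrite core_size_cons0.
(* The entry [k] in front of [0 :: a] belongs to residue [m + 2]; the fractions are the sums of
   ['C(k, 2)] and of [k] over [k] from 1 to [d]. *)
rewrite IH2 (eq_big_seq (fun a : seq nat => d%:R * core_size n a
   + ((n%:R - 1) * ((d%:R - 1) * d%:R * (d%:R + 1) / 6)
      + (m%:R + 2) * (d%:R * (d%:R + 1) / 2))
   - d%:R * (d%:R + 1) / 2 * (sumn a)%:R)); last first.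
  move=> a; rewrite mem_bead_counts => /and3P[/eqP sz _ _].
  under eq_bigr do rewrite core_size_cons core_size_cons0 /= add0n sz.
  rewrite sumrB 2!big_split /= sum_const_seq size_iota subn1 -!mulr_suml -mulr_sumr.
  by rewrite sum_id_rat sum_bin2_rat -(natr1 m); field.
rewrite sumrB big_split /= sum_const_seq -!mulr_sumr IH1.
rewrite size_bead_counts sum_sumn_bead_counts /core_size_sum.
rewrite (M_recS d m.+1) (M_recS d m); move: (M d m.+1) (M d m) => v w.
rewrite !natrD !natrM -!natr1; field.
exact: nz.
Qed.

(** * The expectation *)

Lemma perm_distinct_cores d n : (0 < d)%N -> (0 < n)%N ->
  finite_set (distinct_cores n (d * n + 1)) /\
  perm_eq (fset_set (distinct_cores n (d * n + 1)))
    [seq core_of_counts n a | a <- bead_counts d n.-1].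
Proof.
move=> d_gt0 n_gt0; set s := map _ _.
have memE la : distinct_cores n (d * n + 1) la <-> la \in s.
  split=> [/(distinct_core_counts _ _ _ d_gt0 n_gt0)[a a_in ->] | /mapP[a a_in ->]].
    exact: map_f.
  exact: core_of_counts_distinct.
have fin : finite_set (distinct_cores n (d * n + 1)).
  by apply/finite_seqP; exists s; apply/seteqP; split=> la /memE.
split=> //; apply: uniq_perm; first exact: fset_uniq.
  rewrite map_inj_in_uniq ?uniq_bead_counts // => a b.
  rewrite !mem_bead_counts => /and3P[/eqP sz_a _ _] /and3P[/eqP sz_b _ _].
  by apply: core_of_counts_inj; rewrite ?sz_a ?sz_b prednK.
by move=> la; rewrite in_fset_set //; apply/idP/idP; rewrite inE => /memE.
Qed.

Theorem theorem1p10 (d n : nat) (d_gt0 : (0 < d)%N) (n_gt0 : (0 < n)%N) :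
  finite_set (distinct_cores n (d * n + 1)) /\
  let D : rat := d%:R in
  let N : rat := n%:R in
  expected_core_size n (d * n + 1) =
    D * (D + 1) * (5 * D + 1) * (N - 1) ^+ 2 / (24 * (4 * D + 1))
    + D * (D + 1) * (32 * D ^+ 2 + 63 * D + 7) * (N - 1)
        / (24 * (4 * D + 1) ^+ 2)
    + D * (D + 1) * (6 * D ^+ 2 + 27 * D + 3) / (12 * (4 * D + 1) ^+ 2)
    - (M d n.-1)%:R / (M d n)%:R *
      (D * (D + 1) * (D - 1) * (N - 1) ^+ 2 / (24 * (4 * D + 1))
       + D * (D + 1) * (14 * D ^+ 2 + 21 * D + 1) * (N - 1)
           / (24 * (4 * D + 1) ^+ 2)
       + D * (D + 1) * (6 * D ^+ 2 + 27 * D + 3) / (12 * (4 * D + 1) ^+ 2)).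
Proof.
have [fin perm_s] := perm_distinct_cores d n d_gt0 n_gt0.
split=> // D N; rewrite /expected_core_size /uniform_expectation.
rewrite (perm_big _ perm_s) (perm_size perm_s) size_map size_bead_counts big_map.
have psizeE a : a \in bead_counts d n.-1 ->
    (psize (core_of_counts n a))%:R = core_size n a.
  rewrite mem_bead_counts => /and3P[/eqP sz _ _].
  rewrite /core_size -psize_core_of_counts ?sz ?prednK //.
  by rewrite natrD addrK.
rewrite (eq_big_seq _ psizeE) sum_core_size prednK // /core_size_sum.
have -> : n.-1%:R = N - 1 by rewrite /N -(prednK n_gt0) -natr1 addrK.
(* [M d n] counts a set of lists that contains the all-zero one. *)
have M_neq0 : (M d n)%:R != 0 :> rat.
  rewrite pnatr_eq0 -lt0n -(prednK n_gt0) -size_bead_counts lt0n size_eq0.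
  apply/eqP => nil; have := mem_bead_counts d n.-1 (nseq n.-1 0%N).
  rewrite nil size_nseq eqxx all_nseq orbT /=.
  by elim: n.-1 {nil} => //= k; case: k.
have nz := four_mul_add1_neq0 d.
rewrite -/D -/N; field.
by rewrite M_neq0 nz.
Qed.
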